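(* For every integer $n\ge2$ and every real $q>1$, $$\mathfrak F^{\sharp}(n,q)=\mathfrak F(n,q),\qquad \frac{\partial}{\partial z}\mathfrak F^{\sharp}(z,q)\Big|_{z=n}=0.$$
   Context: For $z\in\mathbb C$ and an integer $i\ge2$, $F(z,i)=i+2\sum_{k=1}^{i-1}(i-k)\cos(2\pi kz/i)$. For $q>1$, with $q^{-z}=e^{-z\log q}$ (real $\log q$), put $S_q(z)=\sum_{i\ge2}q^{-i}\frac{F(z,i)}{i^2}$, $S_1(z)=\frac{\sin(2\pi z)}{2\pi}$, and $$\mathfrak F(z,q)=(q-1)q\bigl(S_q(z)-q^{-z}\bigr),\qquad \mathfrak F^{\sharp}(z,q)=(q-1)q\Big(S_q(z)-q^{-z}\bigl(1+(\log q)S_1(z)\bigr)\Big).$$ *)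

(* Defs.v *)
From Stdlib Require Import Reals.
From Coquelicot Require Import Coquelicot.
Open Scope C_scope.

Definition Cexp (z : C) : C := (exp (Re z) * cos (Im z), exp (Re z) * sin (Im z))%R.

Definition Ccos (z : C) : C := (Cexp (Ci * z) + Cexp (- (Ci * z))) / 2.

Definition Csin (z : C) : C := (Cexp (Ci * z) - Cexp (- (Ci * z))) / (2 * Ci).

(* Coquelicot's [Series] is real-valued only; like it, [CSeries] is total, and
   [is_CSeries_unique] relates it to convergence in [C]. *)
Definition CSeries (a : nat -> C) : C :=
  (Series (fun n => Re (a n)), Series (fun n => Im (a n))).

Lemma is_CSeries_unique (a : nat -> C) (l : C) :
  is_series (K := C_AbsRing) (V := C_NormedModule) a l -> CSeries a = l.
Proof.
  intros H.
  assert (E : forall n, sum_n a n = (sum_n (fun k => Re (a k)) n,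
                                     sum_n (fun k => Im (a k)) n)).
  { induction n as [|n IH].
    - rewrite !sum_O. now destruct (a O).
    - rewrite !sum_Sn, IH. reflexivity. }
  assert (H' := proj1 (filterlim_locally _ l) H).
  destruct l as [lr li]. unfold CSeries. f_equal.
  - apply is_series_unique, filterlim_locally. intros eps.
    destruct (H' eps) as [N HN]. exists N. intros n Hn.
    specialize (HN n Hn). rewrite E in HN. exact (proj1 HN).
  - apply is_series_unique, filterlim_locally. intros eps.
    destruct (H' eps) as [N HN]. exists N. intros n Hn.
    specialize (HN n Hn). rewrite E in HN. exact (proj2 HN).
Qed.

Definition F (z : C) (i : nat) : C :=
  INR i + 2 * sum_n_m (G := C_AbelianMonoid)
                (fun k => INR (i - k) * Ccos (2 * PI * INR k * z / INR i)) 1 (i - 1).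

(* [q ^ (- z)] for real [q > 0]. *)
Definition qpow_opp (q : R) (z : C) : C := Cexp (- z * ln q).

(* The series runs over [i >= 2], whence the shift [i = m + 2]. *)
Definition S_ (q : R) (z : C) : C :=
  CSeries (fun m => let i := (m + 2)%nat in / (RtoC q ^ i) * (F z i / RtoC (INR i) ^ 2)).

Definition S_1 (z : C) : C := Csin (2 * PI * z) / (2 * PI).

Definition frakF (z : C) (q : R) : C :=
  (q - 1) * q * (S_ q z - qpow_opp q z).

Definition frakF_sharp (z : C) (q : R) : C :=
  (q - 1) * q * (S_ q z - qpow_opp q z * (1 + ln q * S_1 z)).

(* Main.v *)
Require Import Defs.
From Stdlib Require Import Reals Lra Lia.
From Coquelicot Require Import Coquelicot.
Open Scope C_scope.

(** At an integer [n] the correction [1 + (ln q) S_1(z)] has value [1] and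
    derivative [ln q], because [S_1(n) = 0] and [S_1'(n) = 1].  The first fact
    gives the equality of values; by the second, the logarithmic derivative
    [ln q] of the correction cancels the one of [q^(-z)], which is [- ln q], so
    that their product is stationary at [n]
    ([quadratic_contact_corrected_power_integer]).

    It remains to see that [S_q] is stationary at [n].  Each [F(., i)] is:
    on the real line it is the Fejer kernel [(sin (pi z) / sin (pi z / i))^2],
    which at an integer has a double zero or its maximum [i^2].  The argument
    below works with the cosine sum instead.  Its derivative at [n] is, up to a
    factor, the sum of [(i - k) k sin (2 pi k n / i)], and the exchange of [k]
    and [i - k] changes the sign of every term ([sum_n_m_antisym]).

    To pass to the series, differentiability of each term does not suffice, but a
    second-order estimate uniform in [i] does: for [|h| <= 1] the frequencies
    [2 pi k / i] stay below [2 pi], hence [|F(n+h, i) - F(n, i)| <= M i^2 |h|^2]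
    with [M] independent of [i] ([F_integer_contact]).  Divided by [i^2] and
    summed against [q^(-i)], this gives [|S_q(n+h) - S_q(n)| <= M' |h|^2].

    All derivatives are therefore expressed by such quadratic estimates
    ([quadratic_contact]), which are stable under sums and products and imply
    complex differentiability. *)

(** * First-order expansions with quadratic remainder *)

(** Stronger than having derivative [l] at [z0]: the remainder is required to be
    quadratic on the whole unit disc around [z0], in the form in which it can be
    summed over a series. *)
Definition quadratic_contact (f : C -> C) (z0 l : C) : Prop :=
  exists M : R, forall z : C, (Cmod (z - z0) <= 1)%R ->
    (Cmod (f z - f z0 - l * (z - z0)) <= M * Cmod (z - z0) ^ 2)%R.

Lemma quadratic_contact_is_derive (f : C -> C) (z0 l : C) :
  quadratic_contact f z0 l ->
  is_derive (K := C_AbsRing) (V := C_NormedModule) f z0 l.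
Proof.
  intros [M HM]. split; [apply is_linear_scal_l|].
  intros x Hx eps.
  assert (E : z0 = x)
    by exact (is_filter_lim_locally_unique (K := C_AbsRing)
                (V := AbsRing_NormedModule C_AbsRing) z0 x Hx).
  subst x.
  assert (HK : (0 < Rabs M + 1)%R) by (pose proof (Rabs_pos M); lra).
  assert (Hd : (0 < Rmin 1 (eps / (Rabs M + 1)))%R).
  { apply Rmin_glb_lt; [lra|]. apply Rdiv_lt_0_compat; [apply cond_pos|lra]. }
  exists (mkposreal _ Hd). intros z Hz.
  change (Cmod (z - z0) < Rmin 1 (eps / (Rabs M + 1)))%R in Hz.
  change (Cmod (f z - f z0 - (z - z0) * l) <= eps * Cmod (z - z0))%R.
  rewrite (Cmult_comm (z - z0)).
  pose proof (Rmin_l 1 (eps / (Rabs M + 1))). pose proof (Rmin_r 1 (eps / (Rabs M + 1))).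
  eapply Rle_trans; [apply HM; lra|].
  replace (M * Cmod (z - z0) ^ 2)%R with (M * Cmod (z - z0) * Cmod (z - z0))%R by ring.
  apply Rmult_le_compat_r; [apply Cmod_ge_0|].
  assert (Cmod (z - z0) * (Rabs M + 1) <= eps)%R.
  { apply Rmult_le_reg_r with (/ (Rabs M + 1))%R; [now apply Rinv_0_lt_compat|].
    rewrite Rmult_assoc, Rinv_r by lra. unfold Rdiv in *. lra. }
  pose proof (Cmod_ge_0 (z - z0)). pose proof (Rle_abs M). nra.
Qed.

Lemma quadratic_contact_const (c z0 : C) : quadratic_contact (fun _ => c) z0 0.
Proof.
  exists 0%R. intros z _.
  replace (c - c - 0 * (z - z0)) with (RtoC 0) by ring.
  rewrite Cmod_0. lra.
Qed.

Lemma quadratic_contact_plus (f g : C -> C) (z0 l m : C) :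
  quadratic_contact f z0 l -> quadratic_contact g z0 m ->
  quadratic_contact (fun z => f z + g z) z0 (l + m).
Proof.
  intros [M HM] [N HN]. exists (M + N)%R. intros z Hz.
  replace (f z + g z - (f z0 + g z0) - (l + m) * (z - z0))
    with ((f z - f z0 - l * (z - z0)) + (g z - g z0 - m * (z - z0))) by ring.
  eapply Rle_trans; [apply Cmod_triangle|].
  specialize (HM z Hz). specialize (HN z Hz). lra.
Qed.

Lemma quadratic_contact_mult (f g : C -> C) (z0 l m : C) :
  quadratic_contact f z0 l -> quadratic_contact g z0 m ->
  quadratic_contact (fun z => f z * g z) z0 (l * g z0 + f z0 * m).
Proof.
  intros [M HM] [N HN].
  exists (M * (Cmod (g z0) + Cmod m + N) + (Cmod (f z0) + Cmod l) * N
          + Cmod l * Cmod m)%R.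
  intros z Hz. specialize (HM z Hz). specialize (HN z Hz).
  set (h := z - z0) in *.
  set (r := f z - f z0 - l * h) in *. set (s := g z - g z0 - m * h) in *.
  (* Multiplying out [f = f z0 + l h + r] and [g = g z0 + m h + s], every term
     left over contains [r], [s] or [h^2]. *)
  replace (f z * g z - f z0 * g z0 - (l * g z0 + f z0 * m) * h)
    with (r * (g z0 + m * h + s) + (f z0 + l * h) * s + l * m * (h * h))
    by (unfold r, s; ring).
  pose proof (Cmod_ge_0 h) as Hh. pose proof (Cmod_ge_0 l). pose proof (Cmod_ge_0 m).
  assert (Hh2 : (Cmod h ^ 2 <= 1)%R) by nra.
  pose proof (Cmod_ge_0 r). pose proof (Cmod_ge_0 s).
  pose proof (Cmod_ge_0 (g z0)). pose proof (Cmod_ge_0 (f z0)).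
  (* The bound [|s| <= N |h|^2] gives [|s| <= N] only once [N >= 0] is known,
     which it implies only when [h <> 0]. *)
  assert (Hs : (Cmod s <= N)%R \/ Cmod h = 0%R).
  { destruct (Req_dec (Cmod h) 0) as [E|E]; [now right|left].
    assert (0 < Cmod h ^ 2)%R by (apply pow_lt; lra).
    assert (0 <= N)%R by nra. nra. }
  assert (Cmod (g z0 + m * h + s) <= Cmod (g z0) + Cmod m * Cmod h + Cmod s)%R.
  { eapply Rle_trans; [apply Cmod_triangle|]. apply Rplus_le_compat_r.
    eapply Rle_trans; [apply Cmod_triangle|]. rewrite Cmod_mult. lra. }
  assert (Cmod (f z0 + l * h) <= Cmod (f z0) + Cmod l * Cmod h)%R.
  { eapply Rle_trans; [apply Cmod_triangle|]. rewrite Cmod_mult. lra. }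
  eapply Rle_trans; [apply Cmod_triangle|].
  rewrite !Cmod_mult.
  replace (Cmod h * Cmod h)%R with (Cmod h ^ 2)%R by ring.
  rewrite !Rmult_plus_distr_r. apply Rplus_le_compat_r.
  eapply Rle_trans; [apply Cmod_triangle|].
  rewrite !Cmod_mult. rewrite <- Rmult_plus_distr_r.
  assert (Hg : (Cmod r * Cmod (g z0 + m * h + s) <=
    (M * Cmod h ^ 2) * (Cmod (g z0) + Cmod m + N))%R).
  { destruct Hs as [Hs|E].
    - apply Rmult_le_compat; try apply Cmod_ge_0; auto. nra.
    - rewrite E in HM |- *. assert (Er : Cmod r = 0%R) by nra. rewrite Er. lra. }
  assert (Hf : (Cmod (f z0 + l * h) * Cmod s <=
    (Cmod (f z0) + Cmod l) * (N * Cmod h ^ 2))%R).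
  { apply Rmult_le_compat; try apply Cmod_ge_0; auto. nra. }
  lra.
Qed.

(** * The complex exponential *)

Lemma exp_le_mono (x y : R) : (x <= y)%R -> (exp x <= exp y)%R.
Proof. intros [H| ->]; [left; now apply exp_increasing|lra]. Qed.

Lemma exp_sub_1_bound (x : R) : (Rabs (exp x - 1) <= Rabs x * exp (Rabs x))%R.
Proof.
  pose proof (exp_ineq1_le x) as Hx. pose proof (exp_ineq1_le (- x)) as Hnx.
  pose proof (exp_pos x) as P.
  assert (exp x * exp (- x) = 1)%R as E by (rewrite <- exp_plus, Rplus_opp_r; apply exp_0).
  destruct (Rle_dec 0 x) as [H|H].
  - rewrite !(Rabs_pos_eq x) by lra. rewrite Rabs_pos_eq by lra. nra.
  - rewrite !(Rabs_left x) by lra. rewrite Rabs_left1.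
    + nra.
    + assert (1 <= exp (- x))%R by lra. nra.
Qed.

Lemma exp_taylor1_bound (x : R) : (Rabs (exp x - 1 - x) <= x ^ 2 * exp (Rabs x))%R.
Proof.
  pose proof (exp_ineq1_le x) as Hx. pose proof (exp_ineq1_le (- x)) as Hnx.
  pose proof (exp_pos x) as P.
  assert (exp x * exp (- x) = 1)%R as E by (rewrite <- exp_plus, Rplus_opp_r; apply exp_0).
  rewrite Rabs_pos_eq by lra.
  assert (H1 : (exp x - 1 <= x * exp x)%R) by nra.
  destruct (Rle_dec 0 x) as [H|H].
  - rewrite (Rabs_pos_eq x) by lra. nra.
  - rewrite (Rabs_left x) by lra. nra.
Qed.

Lemma Rabs_sin_le (y : R) : (Rabs (sin y) <= Rabs y)%R.
Proof.
  assert (P : forall x : R, (0 < x -> Rabs (sin x) <= x)%R).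
  { intros x Hx. pose proof (sin_lt_x x Hx). pose proof (SIN_bound x).
    apply Rabs_le. split; [|lra].
    destruct (Rle_dec x 1); [|lra].
    assert (0 <= sin x)%R by (apply sin_ge_0; pose proof PI2_3_2; lra). lra. }
  destruct (Rtotal_order y 0) as [H|[H|H]].
  - rewrite (Rabs_left y) by lra.
    rewrite <- Rabs_Ropp, <- sin_neg. apply P; lra.
  - rewrite H, sin_0. lra.
  - rewrite (Rabs_pos_eq y) by lra. now apply P.
Qed.

Lemma one_sub_cos_bound (y : R) : (0 <= 1 - cos y <= y ^ 2 / 2)%R.
Proof.
  pose proof (Rabs_sin_le (y / 2)) as Hs.
  apply Rsqr_le_abs_1 in Hs. unfold Rsqr in Hs.
  pose proof (COS_bound y).
  assert (E : cos y = (1 - 2 * sin (y / 2) * sin (y / 2))%R).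
  { rewrite <- cos_2a_sin. f_equal. lra. }
  lra.
Qed.

Lemma sin_taylor1_bound (y : R) : (Rabs (sin y - y) <= y ^ 2)%R.
Proof.
  (* The derivative [cos c - 1] is at most [|c|] in absolute value: its bounds
     [c^2 / 2] and [2] meet at [|c| = 2]. *)
  destruct (MVT_gen (fun x => sin x - x)%R 0 y (fun x => cos x - 1)%R)
    as (c & Hc & E).
  - intros x _. auto_derive; [trivial|ring].
  - intros x _. apply derivable_continuous_pt. reg.
  - rewrite sin_0 in E.
    replace (sin y - y)%R with ((cos c - 1) * y)%R by lra.
    rewrite Rabs_mult.
    assert (Hcy : (Rabs c <= Rabs y)%R).
    { revert Hc. unfold Rmin, Rmax. destruct (Rle_dec 0 y); intros Hc.
      - rewrite !Rabs_pos_eq; lra.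
      - rewrite !Rabs_left1; lra. }
    pose proof (one_sub_cos_bound c) as B. pose proof (COS_bound c).
    assert (Rabs (cos c - 1) <= Rabs c)%R.
    { rewrite Rabs_left1 by lra.
      rewrite <- pow2_abs in B. pose proof (Rabs_pos c).
      destruct (Rle_dec (Rabs c) 2); [nra|lra]. }
    rewrite <- (pow2_abs y). pose proof (Rabs_pos y). nra.
Qed.

Lemma Cmod_le_Rabs (z : C) : (Cmod z <= Rabs (Re z) + Rabs (Im z))%R.
Proof.
  replace z with (RtoC (Re z) + Ci * RtoC (Im z)) at 1
    by (destruct z; unfold Re, Im; apply injective_projections; simpl; ring).
  eapply Rle_trans; [apply Cmod_triangle|].
  rewrite Cmod_mult, Cmod_Ci, !Cmod_R. lra.
Qed.

Lemma Rabs_Re_le (z : C) : (Rabs (Re z) <= Cmod z)%R.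
Proof. eapply Rle_trans; [apply Rmax_l|apply Rmax_Cmod]. Qed.

Lemma Rabs_Im_le (z : C) : (Rabs (Im z) <= Cmod z)%R.
Proof. eapply Rle_trans; [apply Rmax_r|apply Rmax_Cmod]. Qed.

Lemma Cexp_plus (a b : C) : Cexp (a + b) = Cexp a * Cexp b.
Proof.
  destruct a as [a1 a2], b as [b1 b2]. unfold Cexp, Re, Im.
  apply injective_projections; simpl; rewrite exp_plus, ?cos_plus, ?sin_plus; ring.
Qed.

(** A global estimate: the factor [exp |u|] makes it usable for all frequencies
    [2 pi k / i] at once. *)
Lemma Cexp_taylor1_bound (u : C) :
  (Cmod (Cexp u - 1 - u) <= 3 * exp (Cmod u) * Cmod u ^ 2)%R.
Proof.
  pose proof (Rabs_Re_le u) as Bx. pose proof (Rabs_Im_le u) as By.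
  eapply Rle_trans; [apply Cmod_le_Rabs|].
  destruct u as [x y]. unfold Cexp, Re, Im in *; simpl fst in *; simpl snd in *.
  set (N := Cmod (x, y)) in *.
  pose proof (Rabs_pos x). pose proof (Rabs_pos y).
  assert (HE : (exp (Rabs x) <= exp N)%R).
  { now apply exp_le_mono. }
  pose proof (exp_ineq1_le (Rabs x)) as H1. set (e := exp (Rabs x)) in *.
  assert (HM2 : (y ^ 2 <= N ^ 2)%R) by (rewrite <- pow2_abs; nra).
  assert (HX2 : (Rabs x * Rabs y <= N ^ 2)%R) by nra.
  (* N^2 = x^2 + y^2 absorbs both terms of the real part *)
  assert (HS : (N ^ 2 = x ^ 2 + y ^ 2)%R).
  { unfold N, Cmod. rewrite pow2_sqrt; [reflexivity|]. simpl; nra. }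
  assert (R1 : (Rabs (exp x * cos y + - (1) + - x) <= e * N ^ 2)%R).
  { replace (exp x * cos y + - (1) + - x)%R
      with ((exp x - 1 - x) * cos y + - ((1 + x) * (1 - cos y)))%R by ring.
    eapply Rle_trans; [apply Rabs_triang|]. rewrite Rabs_Ropp, !Rabs_mult.
    pose proof (exp_taylor1_bound x) as T. fold e in T.
    pose proof (one_sub_cos_bound y) as B. pose proof (COS_bound y).
    assert (Rabs (cos y) <= 1)%R by (apply Rabs_le; lra).
    rewrite (Rabs_pos_eq (1 - cos y)) by lra.
    assert (Rabs (1 + x) <= e)%R
      by (eapply Rle_trans; [apply Rabs_triang|]; rewrite Rabs_R1; lra).
    pose proof (Rabs_pos (exp x - 1 - x)). pose proof (Rabs_pos (cos y)).
    pose proof (Rabs_pos (1 + x)).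
    assert (Rabs (exp x - 1 - x) * Rabs (cos y) <= x ^ 2 * e * 1)%R
      by (apply Rmult_le_compat; lra).
    assert (Rabs (1 + x) * (1 - cos y) <= e * (y ^ 2))%R
      by (apply Rmult_le_compat; nra).
    rewrite HS. lra. }
  assert (R2 : (Rabs (exp x * sin y + - 0 + - y) <= e * (2 * N ^ 2))%R).
  { replace (exp x * sin y + - 0 + - y)%R
      with ((exp x - 1) * sin y + (sin y - y))%R by ring.
    eapply Rle_trans; [apply Rabs_triang|]. rewrite Rabs_mult.
    pose proof (exp_sub_1_bound x) as T. fold e in T.
    pose proof (sin_taylor1_bound y) as B.
    assert (Rabs (sin y) <= Rabs y)%R as Bs by apply Rabs_sin_le.
    assert (Rabs (exp x - 1) * Rabs (sin y) <= Rabs x * e * Rabs y)%R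
      by (apply Rmult_le_compat; auto using Rabs_pos).
    nra. }
  assert (0 <= N ^ 2)%R by nra.
  assert (e * N ^ 2 <= exp N * N ^ 2)%R by (apply Rmult_le_compat_r; lra).
  simpl in *. lra.
Qed.

Lemma quadratic_contact_Cexp (c z0 : C) :
  quadratic_contact (fun z => Cexp (c * z)) z0 (c * Cexp (c * z0)).
Proof.
  exists (Cmod (Cexp (c * z0)) * (3 * exp (Cmod c) * Cmod c ^ 2))%R.
  intros z Hz. set (h := z - z0) in *.
  replace (c * z) with (c * z0 + c * h) by (unfold h; ring).
  rewrite Cexp_plus.
  replace (Cexp (c * z0) * Cexp (c * h) - Cexp (c * z0) - c * Cexp (c * z0) * h)
    with (Cexp (c * z0) * (Cexp (c * h) - 1 - c * h)) by ring.
  rewrite Cmod_mult, Rmult_assoc.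
  apply Rmult_le_compat_l; [apply Cmod_ge_0|].
  eapply Rle_trans; [apply Cexp_taylor1_bound|].
  rewrite Cmod_mult, Rpow_mult_distr.
  pose proof (Cmod_ge_0 c). pose proof (Cmod_ge_0 h).
  rewrite <- (Rmult_assoc _ _ (Cmod h ^ 2)).
  apply Rmult_le_compat_r; [nra|]. apply Rmult_le_compat_r; [nra|].
  apply Rmult_le_compat_l; [lra|].
  apply exp_le_mono. nra.
Qed.

Lemma Cexp_imaginary (w : R) : Cexp (Ci * w) = (cos w, sin w).
Proof.
  unfold Cexp. simpl. apply injective_projections; simpl;
  replace (0 * w - 1 * 0)%R with 0%R by ring;
  replace (0 * 0 + 1 * w)%R with w by ring; rewrite exp_0; ring.
Qed.

Lemma Cexp_neg_imaginary (w : R) : Cexp (- (Ci * w)) = (cos w, - sin w)%R.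
Proof.
  replace (- (Ci * w)) with (Ci * RtoC (- w)) by (rewrite RtoC_opp; ring).
  now rewrite Cexp_imaginary, cos_neg, sin_neg.
Qed.

Lemma Cmod_unit (w : R) (s : R) : (s ^ 2 = sin w ^ 2)%R -> Cmod (cos w, s) = 1%R.
Proof.
  intros Hs. unfold Cmod; simpl fst; simpl snd. rewrite Hs.
  pose proof (sin2_cos2 w) as E. unfold Rsqr in E.
  replace (cos w ^ 2 + sin w ^ 2)%R with 1%R by lra. apply sqrt_1.
Qed.

Lemma Ccos_real (w : R) : Ccos w = cos w.
Proof.
  unfold Ccos. rewrite Cexp_imaginary, Cexp_neg_imaginary.
  replace ((cos w, sin w) + (cos w, (- sin w)%R)) with (2 * RtoC (cos w))
    by (apply injective_projections; simpl; ring).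
  field.
Qed.

Lemma Csin_real (w : R) : Csin w = sin w.
Proof.
  unfold Csin. rewrite Cexp_imaginary, Cexp_neg_imaginary.
  replace ((cos w, sin w) - (cos w, (- sin w)%R)) with (2 * Ci * RtoC (sin w))
    by (apply injective_projections; simpl; ring).
  field. intros E. apply (f_equal snd) in E. simpl in E. lra.
Qed.

(** Writing [cos] by exponentials, the linear terms of [Cexp (i u)] and
    [Cexp (- i u)] add up to [- u sin w]; the two remainders are multiplied by
    [exp (i w)] and [exp (- i w)], of modulus [1] since [w] is real. *)
Lemma Ccos_taylor1_bound (w : R) (u : C) :
  (Cmod (Ccos (w + u) - Ccos w + u * sin w) <= 3 * exp (Cmod u) * Cmod u ^ 2)%R.
Proof.
  pose proof (Cexp_taylor1_bound (Ci * u)) as B1.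
  pose proof (Cexp_taylor1_bound (- (Ci * u))) as B2.
  rewrite Cmod_opp in B2. rewrite Cmod_mult, Cmod_Ci, Rmult_1_l in B1, B2.
  set (e1 := Cexp (Ci * u) - 1 - Ci * u) in *.
  set (e2 := Cexp (- (Ci * u)) - 1 - - (Ci * u)) in *.
  assert (HC : Ci * Ci = - (1)) by (apply injective_projections; simpl; ring).
  assert (E : Ccos (w + u) - Ccos w + u * sin w
     = (Cexp (Ci * w) * e1 + Cexp (- (Ci * w)) * e2) / 2).
  { unfold Ccos, e1, e2.
    replace (Ci * (w + u)) with (Ci * w + Ci * u) by ring.
    replace (- (Ci * w + Ci * u)) with (- (Ci * w) + - (Ci * u)) by ring.
    rewrite !Cexp_plus.
    assert (Es : RtoC (sin w) = - Ci * (Cexp (Ci * w) - Cexp (- (Ci * w))) / 2).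
    { rewrite Cexp_imaginary, Cexp_neg_imaginary.
      replace ((cos w, sin w) - (cos w, (- sin w)%R)) with (2 * Ci * RtoC (sin w))
        by (apply injective_projections; simpl; ring).
      replace (- Ci * (2 * Ci * RtoC (sin w)) / 2) with (- (Ci * Ci) * RtoC (sin w)) by field.
      rewrite HC. ring. }
    rewrite Es. field. }
  rewrite E. unfold Cdiv. rewrite Cmod_mult.
  assert (E2 : Cmod (/ 2) = (/ 2)%R).
  { rewrite <- RtoC_inv, Cmod_R by lra. apply Rabs_pos_eq. lra. }
  rewrite E2.
  assert (Cmod (Cexp (Ci * w) * e1 + Cexp (- (Ci * w)) * e2) <= Cmod e1 + Cmod e2)%R.
  { eapply Rle_trans; [apply Cmod_triangle|]. rewrite !Cmod_mult.
    rewrite Cexp_imaginary, Cexp_neg_imaginary, !Cmod_unit by ring. lra. }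
  lra.
Qed.

(** * Antisymmetric and weighted sums *)

Lemma sum_n_reflect {G : AbelianMonoid} (g : nat -> G) (N : nat) :
  sum_n g N = sum_n (fun k => g (N - k)%nat) N.
Proof.
  induction N as [|N IH] in g |- *.
  - now rewrite !sum_O.
  - rewrite sum_Sn. rewrite (IH g).
    unfold sum_n at 2. rewrite sum_Sn_m by lia. rewrite <- sum_n_m_S.
    rewrite plus_comm. reflexivity.
Qed.

(** The reflection of the index maps the sum to its opposite. *)
Lemma sum_n_m_antisym (g : nat -> C) (i : nat) :
  (2 <= i)%nat ->
  (forall k, (1 <= k <= i - 1)%nat -> g (i - k)%nat = - g k) ->
  sum_n_m (G := C_AbelianMonoid) g 1 (i - 1) = RtoC 0.
Proof.
  intros Hi Hg. destruct i as [|[|m]]; try lia.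
  replace (S (S m) - 1)%nat with (S m) in * by lia.
  rewrite <- (sum_n_m_S (G := C_AbelianMonoid)).
  set (s := sum_n_m _ 0 m). change C in (type of s). change (s = 0 :> C).
  assert (E : s = - s).
  { unfold s at 1.
    change (sum_n (G := C_AbelianMonoid) (fun k => g (S k)) m = - s).
    rewrite sum_n_reflect. unfold s, sum_n.
    rewrite (sum_n_m_ext_loc (G := C_AbelianMonoid) _
               (fun k => mult (K := C_Ring) (- (1)) (g (S k)))).
    - etransitivity; [apply (sum_n_m_mult_l (K := C_Ring) (- (1)) (fun k => g (S k)))|].
      change (- (1) * s = - s). ring.
    - intros k Hk. change (g (S (m - k)) = - (1) * g (S k)).
      replace (S (m - k)) with (S (S m) - S k)%nat by lia.
      rewrite Hg by lia. ring. }
  replace s with ((s + s) / 2) by field.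
  rewrite E at 2. field.
Qed.

Lemma weighted_sum_bound (c : nat -> C) (i : nat) (B : R) :
  (forall k, (k <= i)%nat -> Cmod (c k) <= B)%R ->
  (Cmod (sum_n_m (G := C_AbelianMonoid) (fun k => (INR (i - k) * c k)%C) 1 (i - 1))
   <= INR i ^ 2 * B)%R.
Proof.
  intros Hc.
  assert (HB : (0 <= B)%R).
  { eapply Rle_trans; [apply Cmod_ge_0|apply (Hc 0%nat); lia]. }
  (* Termwise comparison of sums asks for the inequality at every index, so the
     terms beyond [i] are cut off first. *)
  rewrite (sum_n_m_ext_loc (G := C_AbelianMonoid) _
    (fun k => if Nat.leb k i then INR (i - k) * c k else RtoC 0)).
  2:{ intros k Hk. rewrite (proj2 (Nat.leb_le k i)); [reflexivity|lia]. }
  eapply Rle_trans; [apply (norm_sum_n_m (K := C_AbsRing) (V := C_NormedModule))|].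
  eapply Rle_trans.
  - apply (sum_n_m_le _ (fun _ => INR i * B)%R). intros k.
    change (Cmod (if Nat.leb k i then (INR (i - k) * c k)%C else RtoC 0) <= INR i * B)%R.
    destruct (Nat.leb_spec k i).
    + rewrite Cmod_mult, Cmod_R, Rabs_pos_eq by apply pos_INR.
      apply Rmult_le_compat; auto using pos_INR, Cmod_ge_0.
      apply le_INR. lia.
    + rewrite Cmod_0. apply Rmult_le_pos; [apply pos_INR|auto].
  - rewrite sum_n_m_const.
    replace (INR i ^ 2 * B)%R with (INR i * (INR i * B))%R by ring.
    apply Rmult_le_compat_r; [apply Rmult_le_pos; [apply pos_INR|auto]|].
    apply le_INR. lia.
Qed.

(** * The kernels F(., i) near an integer *)

Lemma F_integer_bound (n i : nat) : (1 <= i)%nat -> (Cmod (F (INR n) i) <= 3 * INR i ^ 2)%R.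
Proof.
  intros Hi. unfold F.
  assert (H1 : (1 <= INR i)%R) by (apply (le_INR 1); lia).
  assert (B : (Cmod (sum_n_m (G := C_AbelianMonoid)
     (fun k => (INR (i - k) * Ccos (2 * PI * INR k * INR n / INR i))%C) 1 (i - 1))
     <= INR i ^ 2 * 1)%R).
  { apply (weighted_sum_bound (fun k => Ccos (2 * PI * INR k * INR n / INR i))).
    intros k _.
    replace (2 * PI * INR k * INR n / INR i)
      with (RtoC (2 * PI * INR k * INR n / INR i))
      by (rewrite RtoC_div, !RtoC_mult by lra; reflexivity).
    rewrite Ccos_real, Cmod_R. apply Rabs_le, COS_bound. }
  eapply Rle_trans; [apply Cmod_triangle|].
  rewrite Cmod_mult, !Cmod_R, (Rabs_pos_eq (INR i)), (Rabs_pos_eq 2) by lra.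
  nra.
Qed.

(** Twice the constant of [Ccos_taylor1_bound] for [|u| <= 2 pi |h|] and
    [|h| <= 1]; the factor [2] is the one in front of the sum in [F]. *)
Definition kernel_constant : R := (2 * (3 * exp (2 * PI) * (2 * PI) ^ 2))%R.

(** Expanding every cosine at [n] to first order, the linear terms cancel by
    antisymmetry under [k -> i - k], and the remainders are controlled uniformly
    in [k <= i]. *)
Lemma F_integer_contact (n i : nat) (z : C) :
  (2 <= i)%nat -> (Cmod (z - INR n) <= 1)%R ->
  (Cmod (F z i - F (INR n) i)
   <= INR i ^ 2 * (kernel_constant * Cmod (z - INR n) ^ 2))%R.
Proof.
  intros Hi Hz. set (h := z - INR n) in *.
  assert (H1 : (2 <= INR i)%R) by (apply (le_INR 2); lia).
  assert (Hi0 : RtoC (INR i) <> 0).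
  { intros E. apply (f_equal fst) in E. simpl in E. lra. }
  pose proof PI_RGT_0 as HPI.
  set (w := fun k : nat => (2 * PI * INR k * INR n / INR i)%R).
  set (u := fun k : nat => 2 * PI * INR k / INR i * h).
  assert (Ew : forall k, 2 * PI * INR k * INR n / INR i = RtoC (w k)).
  { intros k. unfold w. rewrite RtoC_div, !RtoC_mult by lra. reflexivity. }
  assert (Ez : forall k, 2 * PI * INR k * z / INR i = RtoC (w k) + u k).
  { intros k. rewrite <- Ew. unfold u, h. field. exact Hi0. }
  set (r := fun k => Ccos (w k + u k) - Ccos (w k) + u k * sin (w k)).
  assert (Hr : forall k, (k <= i)%nat ->
    (Cmod (r k) <= 3 * exp (2 * PI) * (2 * PI) ^ 2 * Cmod h ^ 2)%R).
  { intros k Hk. eapply Rle_trans; [apply Ccos_taylor1_bound|].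
    assert (Hu : (Cmod (u k) <= 2 * PI * Cmod h)%R).
    { unfold u. rewrite Cmod_mult. apply Rmult_le_compat_r; [apply Cmod_ge_0|].
      replace (2 * PI * INR k / INR i) with (RtoC (2 * PI * (INR k / INR i)))
        by (rewrite !RtoC_mult, RtoC_div by lra; field; exact Hi0).
      assert (0 <= INR k / INR i <= 1)%R.
      { pose proof (pos_INR k). pose proof (le_INR k i Hk). split.
        - apply Rmult_le_pos; [lra|]. left. apply Rinv_0_lt_compat. lra.
        - apply Rmult_le_reg_r with (INR i); [lra|]. unfold Rdiv.
          rewrite Rmult_assoc, Rinv_l by lra. lra. }
      rewrite Cmod_R, Rabs_pos_eq; nra. }
    pose proof (Cmod_ge_0 (u k)). pose proof (Cmod_ge_0 h).
    replace (3 * exp (2 * PI) * (2 * PI) ^ 2 * Cmod h ^ 2)%R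
      with (3 * exp (2 * PI) * (2 * PI * Cmod h) ^ 2)%R by ring.
    apply Rmult_le_compat.
    - pose proof (exp_pos (Cmod (u k))). lra.
    - nra.
    - apply Rmult_le_compat_l; [lra|]. apply exp_le_mono. nra.
    - apply pow_incr. lra. }
  assert (E : F z i - F (INR n) i
     = 2 * sum_n_m (G := C_AbelianMonoid) (fun k => INR (i - k) * r k) 1 (i - 1)).
  { unfold F.
    rewrite (sum_n_m_ext_loc (G := C_AbelianMonoid)
      (fun k => INR (i - k) * Ccos (2 * PI * INR k * z / INR i))
      (fun k => plus (INR (i - k) * r k)
        (plus (INR (i - k) * Ccos (2 * PI * INR k * INR n / INR i))
              (- (INR (i - k) * (u k * sin (w k))))))).
    2:{ intros k _. rewrite Ez, Ew. unfold r.
        change (@plus C_AbelianMonoid) with Cplus.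
        match goal with |- ?a = ?b => change (a = b :> C) end. ring. }
    rewrite !(sum_n_m_plus (G := C_AbelianMonoid)).
    change (@plus C_AbelianMonoid) with Cplus.
    rewrite (sum_n_m_antisym (fun k => - (INR (i - k) * (u k * sin (w k))))) by
      (try exact Hi; intros k Hk;
       (* [2 pi (i - k) n / i] equals [- 2 pi k n / i] up to the period
          [2 pi n]; this is where [n] being an integer is used *)
       replace (i - (i - k))%nat with k by lia;
       assert (Es : sin (w (i - k)%nat) = (- sin (w k))%R) by
         (replace (w (i - k)%nat) with (- w k + 2 * INR n * PI)%R
            by (unfold w; rewrite minus_INR by lia; field; lra);
          rewrite sin_period; apply sin_neg);
       rewrite Es, RtoC_opp; unfold u; field; exact Hi0).
    ring. }
  rewrite E, Cmod_mult, Cmod_R, Rabs_pos_eq by lra.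
  pose proof (weighted_sum_bound r i _ Hr). unfold kernel_constant. lra.
Qed.

(** * Termwise expansion of the series *)

Lemma Series_diff_le (a b c : nat -> R) :
  ex_series b -> ex_series c -> (forall m, Rabs (a m - b m) <= c m)%R ->
  (Rabs (Series a - Series b) <= Series c)%R.
Proof.
  intros Hb Hc H.
  assert (Hd : ex_series (fun m => Rabs (a m - b m))).
  { apply (ex_series_le (K := R_AbsRing) (V := R_CompleteNormedModule) _ c); [|exact Hc].
    intros m. change (Rabs (Rabs (a m - b m)) <= c m)%R. rewrite Rabs_Rabsolu. apply H. }
  assert (Ha : ex_series a).
  { apply (ex_series_ext (fun m => (a m - b m) + b m)%R); [intros m; simpl; ring|].
    apply (ex_series_plus (V := R_NormedModule)); [now apply ex_series_Rabs|exact Hb]. }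
  rewrite <- Series_minus by assumption.
  eapply Rle_trans; [now apply Series_Rabs|].
  apply Series_le; [|exact Hc]. intros m. split; [apply Rabs_pos|apply H].
Qed.

(** Summability of [a] comes from that of [b] and of the difference.  The factor
    [2] accounts for real and imaginary part being summed separately. *)
Lemma CSeries_diff_le (a b : nat -> C) (B c : nat -> R) :
  ex_series B -> (forall m, Cmod (b m) <= B m)%R ->
  ex_series c -> (forall m, Cmod (a m - b m) <= c m)%R ->
  (Cmod (CSeries a - CSeries b) <= 2 * Series c)%R.
Proof.
  intros HB Hb Hc Hab.
  eapply Rle_trans; [apply Cmod_le_Rabs|].
  assert (Rabs (Series (fun m => Re (a m)) - Series (fun m => Re (b m))) <= Series c)%R.
  { apply Series_diff_le; [|exact Hc|].
    - apply (ex_series_le (K := R_AbsRing) (V := R_CompleteNormedModule) _ B); [|exact HB].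
      intros m. eapply Rle_trans; [apply Rabs_Re_le|apply Hb].
    - intros m. eapply Rle_trans; [apply (Rabs_Re_le (a m - b m))|apply Hab]. }
  assert (Rabs (Series (fun m => Im (a m)) - Series (fun m => Im (b m))) <= Series c)%R.
  { apply Series_diff_le; [|exact Hc|].
    - apply (ex_series_le (K := R_AbsRing) (V := R_CompleteNormedModule) _ B); [|exact HB].
      intros m. eapply Rle_trans; [apply Rabs_Im_le|apply Hb].
    - intros m. eapply Rle_trans; [apply (Rabs_Im_le (a m - b m))|apply Hab]. }
  unfold CSeries, Re, Im in *. simpl in *. unfold Rminus in *. lra.
Qed.

Lemma quadratic_contact_S_integer (n : nat) (q : R) :
  (1 < q)%R -> quadratic_contact (S_ q) (INR n) 0.
Proof.
  intros hq.
  assert (Hq : (0 < / q < 1)%R).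
  { split; [apply Rinv_0_lt_compat; lra|].
    rewrite <- Rinv_1. apply Rinv_lt_contravar; lra. }
  assert (G : ex_series (fun m => (/ q) ^ (m + 2))%R).
  { apply (ex_series_ext (fun m => scal ((/ q) ^ 2) ((/ q) ^ m))%R).
    - intros m. rewrite pow_add. apply Rmult_comm.
    - apply (ex_series_scal (V := R_NormedModule)), ex_series_geom.
      rewrite Rabs_pos_eq; lra. }
  assert (Gs : forall c : R, ex_series (fun m => c * (/ q) ^ (m + 2))%R)
    by (intros c; exact (ex_series_scal (V := R_NormedModule) c _ G)).
  (* The factor [i^2] granted by the estimates on [F] is the one that the
     definition of the series divides by. *)
  assert (Hterm : forall (m : nat) (x : C) (A : R),
    (Cmod x <= INR (m + 2) ^ 2 * A)%R ->
    (Cmod (/ (RtoC q ^ (m + 2)) * (x / RtoC (INR (m + 2)) ^ 2)) <= A * (/ q) ^ (m + 2))%R).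
  { intros m x A Hx.
    assert (Hi : (0 < INR (m + 2))%R) by (apply lt_0_INR; lia).
    assert (Hi2 : (0 < INR (m + 2) ^ 2)%R) by (apply pow_lt; exact Hi).
    rewrite <- !RtoC_pow, <- RtoC_inv by (apply pow_nonzero; lra).
    unfold Cdiv. rewrite <- RtoC_inv by lra.
    rewrite !Cmod_mult, !Cmod_R, <- pow_inv.
    rewrite (Rabs_pos_eq ((/ q) ^ (m + 2))) by (apply pow_le; lra).
    rewrite (Rabs_pos_eq (/ INR (m + 2) ^ 2)) by (left; now apply Rinv_0_lt_compat).
    rewrite Rmult_comm. apply Rmult_le_compat_r; [apply pow_le; lra|].
    apply Rmult_le_reg_r with (INR (m + 2) ^ 2)%R; [exact Hi2|].
    rewrite Rmult_assoc, Rinv_l by lra. lra. }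
  exists (2 * (kernel_constant * Series (fun m => (/ q) ^ (m + 2))))%R.
  intros z Hz.
  replace (S_ q z - S_ q (INR n) - 0 * (z - INR n))
    with (S_ q z - S_ q (INR n)) by ring.
  set (d := Cmod (z - INR n)) in *.
  replace (2 * (kernel_constant * Series (fun m => (/ q) ^ (m + 2))) * d ^ 2)%R
    with (2 * Series (fun m => (kernel_constant * d ^ 2) * (/ q) ^ (m + 2)))%R
    by (rewrite Series_scal_l; ring).
  unfold S_. apply (CSeries_diff_le _ _ (fun m => 3 * (/ q) ^ (m + 2))%R).
  - apply Gs.
  - intros m. apply Hterm. rewrite Rmult_comm. apply F_integer_bound. lia.
  - apply Gs.
  - intros m. cbv zeta.
    replace (/ RtoC q ^ (m + 2) * (F z (m + 2) / RtoC (INR (m + 2)) ^ 2)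
             - / RtoC q ^ (m + 2) * (F (INR n) (m + 2) / RtoC (INR (m + 2)) ^ 2))
      with (/ RtoC q ^ (m + 2)
            * ((F z (m + 2) - F (INR n) (m + 2)) / RtoC (INR (m + 2)) ^ 2))
      by (unfold Cdiv; ring).
    apply Hterm. apply F_integer_contact; [lia|exact Hz].
Qed.

(** * The correction factor *)

Lemma Cmult_2PI_INR (n : nat) : 2 * PI * INR n = RtoC (2 * PI * INR n).
Proof. now rewrite !RtoC_mult. Qed.

Lemma sin_2PI_INR (n : nat) : sin (2 * PI * INR n) = 0%R.
Proof.
  replace (2 * PI * INR n)%R with (0 + 2 * INR n * PI)%R by ring.
  rewrite sin_period. apply sin_0.
Qed.

Lemma cos_2PI_INR (n : nat) : cos (2 * PI * INR n) = 1%R.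
Proof.
  replace (2 * PI * INR n)%R with (0 + 2 * INR n * PI)%R by ring.
  rewrite cos_period. apply cos_0.
Qed.

Lemma S_1_integer (n : nat) : S_1 (INR n) = 0.
Proof.
  unfold S_1. rewrite Cmult_2PI_INR, Csin_real, sin_2PI_INR.
  unfold Cdiv. ring.
Qed.

Lemma Ctwo_PI_neq_0 : 2 * PI <> 0.
Proof.
  rewrite <- RtoC_mult. intros E. apply (f_equal fst) in E. simpl in E.
  pose proof PI_RGT_0. lra.
Qed.

Lemma quadratic_contact_ext (f g : C -> C) (z0 l m : C) :
  (forall z, f z = g z) -> l = m ->
  quadratic_contact f z0 l -> quadratic_contact g z0 m.
Proof.
  intros E <- [M H]. exists M. intros z Hz. rewrite <- !E. now apply H.
Qed.

Lemma quadratic_contact_S_1_integer (n : nat) : quadratic_contact S_1 (INR n) 1.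
Proof.
  assert (HCi : Ci <> 0).
  { intros E. apply (f_equal snd) in E. simpl in E. lra. }
  pose proof Ctwo_PI_neq_0 as HP.
  eapply quadratic_contact_ext;
    [| |apply quadratic_contact_mult;
        [apply (quadratic_contact_const (/ (2 * Ci * (2 * PI))))
        |apply quadratic_contact_plus;
          [apply (quadratic_contact_Cexp (Ci * (2 * PI)))
          |apply quadratic_contact_mult;
            [apply (quadratic_contact_const (- (1)))
            |apply (quadratic_contact_Cexp (- (Ci * (2 * PI))))]]]].
  - intros z. unfold S_1, Csin. cbv beta.
    replace (Ci * (2 * PI) * z) with (Ci * (2 * PI * z)) by ring.
    replace (- (Ci * (2 * PI)) * z) with (- (Ci * (2 * PI * z))) by ring.
    field. repeat split; auto.
    intros E; apply HP; rewrite E; ring.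
  - cbv beta.
    replace (Ci * (2 * PI) * INR n) with (Ci * RtoC (2 * PI * INR n))
      by (rewrite <- Cmult_2PI_INR; ring).
    replace (- (Ci * (2 * PI)) * INR n) with (- (Ci * RtoC (2 * PI * INR n)))
      by (rewrite <- Cmult_2PI_INR; ring).
    rewrite Cexp_imaginary, Cexp_neg_imaginary, sin_2PI_INR, cos_2PI_INR, Ropp_0.
    change (1%R, 0%R) with (RtoC 1).
    field. repeat split; auto.
    intros E; apply HP; rewrite E; ring.
Qed.

(** The derivative is [- ln q * q^(-n) * (1 + 0) + q^(-n) * ln q * 1 = 0]. *)
Lemma quadratic_contact_corrected_power_integer (n : nat) (q : R) :
  quadratic_contact (fun z => qpow_opp q z * (1 + ln q * S_1 z)) (INR n) 0.
Proof.
  eapply quadratic_contact_ext;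
    [| |apply quadratic_contact_mult;
        [apply (quadratic_contact_Cexp (- ln q))
        |apply quadratic_contact_plus;
          [apply (quadratic_contact_const 1)
          |apply quadratic_contact_mult;
            [apply (quadratic_contact_const (ln q))
            |apply quadratic_contact_S_1_integer]]]].
  - intros z. unfold qpow_opp. cbv beta.
    replace (- z * ln q) with (- ln q * z) by ring. reflexivity.
  - cbv beta. rewrite S_1_integer. ring.
Qed.

Theorem lemma4p12 (n : nat) (q : R) (hn : (2 <= n)%nat) (hq : (1 < q)%R) :
  frakF_sharp (INR n) q = frakF (INR n) q /\
  is_derive (K := C_AbsRing) (V := C_NormedModule)
    (fun z : C => frakF_sharp z q) (RtoC (INR n)) (RtoC 0).
Proof.
  split.
  - unfold frakF_sharp, frakF. rewrite S_1_integer. ring.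
  - apply quadratic_contact_is_derive.
    eapply quadratic_contact_ext;
      [| |apply quadratic_contact_mult;
          [apply (quadratic_contact_const ((q - 1) * q))
          |apply quadratic_contact_plus;
            [apply (quadratic_contact_S_integer n q hq)
            |apply quadratic_contact_mult;
              [apply (quadratic_contact_const (- (1)))
              |apply (quadratic_contact_corrected_power_integer n q)]]]].
    + intros z. unfold frakF_sharp. cbv beta. ring.
    + cbv beta. ring.
Qed.
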